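(* Let $q=(q_1,\ldots,q_n)$ be a weakly increasing sequence of positive integers such that $q_j$ divides $1+\sum_{i\neq j}q_i$ for every $j$, and let $\Delta_{(1,q)}:=\operatorname{conv}\{e_1,\ldots,e_n,-\sum_{i=1}^n q_ie_i\}\subset\mathbb{R}^n$ (a reflexive simplex). Then $\Delta_{(1,q)}$ has the integer decomposition property if and only if the following holds: for every $j=1,\ldots,n$ and every $b\in\{1,\ldots,q_j-1\}$ satisfying \[ b\left(\frac{1+\sum_{i\neq j}q_i}{q_j}\right)-\sum_{i\neq j}\left\lfloor\frac{bq_i}{q_j}\right\rfloor\ \ge\ 2, \] there exists a positive integer $c<b$ such that \[ \left\lfloor\frac{bq_i}{q_j}\right\rfloor-\left\lfloor\frac{cq_i}{q_j}\right\rfloor=\left\lfloor\frac{(b-c)q_i}{q_j}\right\rfloor\quad\text{for all } 1\le i\le n,\ i\neq j, \] and \[ c\left(\frac{1+\sum_{i\neq j}q_i}{q_j}\right)-\sum_{i\neq j}\left\lfloor\frac{cq_i}{q_j}\right\rfloor=1 . \]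
   Context: $e_i$ is the $i$-th standard basis vector of $\mathbb{R}^n$. A lattice polytope $P\subset\mathbb{R}^n$ has the integer decomposition property (is IDP) if for every positive integer $m$ and every $w\in mP\cap\mathbb{Z}^n$ there exist $x_1,\ldots,x_m\in P\cap\mathbb{Z}^n$ with $w=x_1+\cdots+x_m$. All sums $\sum_{i\neq j}$ range over $1\le i\le n$, $i\ne j$. *)

(* Defs.v *)
From HB Require Import structures.
From mathcomp Require Import all_boot all_order all_algebra.
From mathcomp Require Import classical_sets reals.

Set Implicit Arguments.
Unset Strict Implicit.
Unset Printing Implicit Defensive.

Import Order.TTheory GRing.Theory Num.Theory.

Local Open Scope classical_set_scope.
Local Open Scope ring_scope.

Definition conv (R : realType) (n : nat) (A : set 'rV[R]_n) : set 'rV[R]_n :=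
  [set x | exists (k : nat) (t : 'I_k -> R) (v : 'I_k -> 'rV[R]_n),
    [/\ forall i, A (v i), forall i, 0 <= t i, \sum_i t i = 1
      & x = \sum_i t i *: v i]].

Definition lattice_point (R : realType) (n : nat) (x : 'rV[R]_n) : Prop :=
  forall i, x 0 i \is a Num.int.

Definition dilate (R : realType) (n m : nat) (P : set 'rV[R]_n) :
    set 'rV[R]_n :=
  [set m%:R *: x | x in P].

Definition IDP (R : realType) (n : nat) (P : set 'rV[R]_n) : Prop :=
  forall m : nat, (0 < m)%N ->
  forall w : 'rV[R]_n, dilate m P w -> lattice_point w ->
  exists x : 'I_m -> 'rV[R]_n,
    (forall k, P (x k) /\ lattice_point (x k)) /\ w = \sum_k x k.

Definition Delta1 (R : realType) (n : nat) (q : 'I_n -> nat) : set 'rV[R]_n :=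
  conv (range (fun i : 'I_n => delta_mx 0 i : 'rV[R]_n) `|`
        [set - (\sum_i (q i)%:R *: delta_mx 0 i)]).
Arguments Delta1 R {n} q.

(* b * ((1 + sum_(i != j) q_i) / q_j) - sum_(i != j) floor (b * q_i / q_j).
   The first quotient is exact only when q_j divides 1 + sum_(i != j) q_i;
   the subtraction is done in int, since subtraction on nat is truncated. *)
Definition height (n : nat) (q : 'I_n -> nat) (j : 'I_n) (b : nat) : int :=
  (b * ((1 + \sum_(i < n | i != j) q i) %/ q j))%N%:Z
  - (\sum_(i < n | i != j) ((b * q i) %/ q j))%N%:Z.

(* Main.v *)
Require Import Defs.
From mathcomp Require Import all_boot all_order all_algebra.
From mathcomp Require Import classical_sets reals.
From mathcomp Require Import zify ring lra.

Set Implicit Arguments.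
Unset Strict Implicit.
Unset Printing Implicit Defensive.

Import Order.TTheory GRing.Theory Num.Theory.

Local Open Scope ring_scope.

(** Write Q = 1 + q_1 + ... + q_n and s_i = Q / q_i, an integer by the
    divisibility hypothesis.  A lattice point w at height m is determined by w
    and k = m - (w_1 + ... + w_n), and it lies in m Delta iff k >= 0 and
    w_i >= - floor (k / s_i) for all i.  Subtracting the vertices e_i reduces
    the integer decomposition property to the points w_i = - floor (k / s_i),
    of height h k = k - sum_i floor (k / s_i), and these must split off a point
    of height 1.  For k >= Q the vertex - sum_i q_i e_i, i.e. k' = Q, splits
    off; if no s_j divides k, then the interior point 0, i.e. k' = 1, does.
    The remaining case k = s_j b is the numerical condition of the theorem. *)

Lemma Posz_sum (I : finType) (P : pred I) (F : I -> nat) :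
  (\sum_(i | P i) F i)%N%:Z = \sum_(i | P i) (F i)%:Z.
Proof. by rewrite -natz natr_sum; apply: eq_bigr => i _; rewrite natz. Qed.

(** * Integer decomposition in terms of floors, for arbitrary slopes *)

Section Slopes.

Variables (n : nat) (s : 'I_n -> nat).

Definition floor_height (k : nat) : int := k%:Z - \sum_i (k %/ s i)%N%:Z.

(** The floor identity says that the minimal lattice point over [k], with coordinates
    [- (k %/ s i)], is the sum of those over [c] and [k - c]. *)
Definition splits_off (k c : nat) : Prop :=
  [/\ (0 < c)%N, (c < k)%N,
      (forall i, k %/ s i = c %/ s i + (k - c) %/ s i)%N
    & floor_height c = 1].

Definition floor_decomposable : Prop :=
  forall k : nat, 2 <= floor_height k -> exists c, splits_off k c.

Definition level (z : 'I_n -> int) (m : nat) : int := m%:Z - \sum_i z i.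

(** For [s := slope] these are the facet inequalities of the cone over the simplex. The first comes
    from the facet opposite the apex [- q], the others from the facets opposite the [e_i]. *)
Definition in_cone (z : 'I_n -> int) (m : nat) : Prop :=
  0 <= level z m /\ forall i, 0 <= z i * (s i)%:Z + level z m.

(** The family [x] is indexed by [nat], so that an induction on [m] can append a term without casts
    between ordinals. *)
Definition cone_decomposable : Prop :=
  forall (m : nat) (z : 'I_n -> int), (0 < m)%N -> in_cone z m ->
  exists x : nat -> 'I_n -> int,
    (forall l, (l < m)%N -> in_cone (x l) 1) /\
    (forall i, z i = \sum_(l < m) x l i).

Lemma levelB z y m :
  level (fun i => z i - y i) m = level z m.+1 - level y 1.
Proof. by rewrite /level sumrB -addn1 PoszD; ring. Qed.

Hypothesis s_gt0 : forall i, (0 < s i)%N.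

(** Since [z i] is an integer, its lower bound [- k / s i] may be rounded up to [- (k %/ s i)]. *)
Lemma in_coneP z m : in_cone z m <->
  exists k : nat, level z m = k%:Z /\ forall i, 0 <= z i + (k %/ s i)%N%:Z.
Proof.
have key (k : nat) i :
    (0 <= z i * (s i)%:Z + k%:Z) = (0 <= z i + (k %/ s i)%N%:Z).
  have := s_gt0 i; have := divn_eq k (s i); have := ltn_pmod k (s_gt0 i).
  move: (k %/ s i)%N (k %% s i)%N => d r ltrs -> s0.
  apply/idP/idP; nia.
split=> [[lev0 H]|[k [E H]]]; last by rewrite /in_cone E; split=> // i; rewrite key.
have E : level z m = `|level z m|%N%:Z by rewrite gez0_abs.
by exists `|level z m|%N; split=> // i; rewrite -key -E.
Qed.

(** Decompose the minimal point over [k] into points of height 1. A summand of positive level [c]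
    splits off, and [c = k] is excluded because the heights differ. *)
Lemma cone_decomposable_floor : cone_decomposable -> floor_decomposable.
Proof.
move=> dec k hk.
pose m := `|floor_height k|%N.
have Em : m%:Z = floor_height k by rewrite /m; lia.
pose z i : int := - (k %/ s i)%N%:Z.
have Ek : level z m = k%:Z.
  by rewrite /level Em /floor_height /z sumrN opprK subrK.
have [||x [xin zE]] := dec m z; first by lia.
  by apply/in_coneP; exists k; split=> // i; rewrite /z addNr.
have /fin_all_exists [kk kkP] : forall l : 'I_m, exists c : nat,
    level (x l) 1 = c%:Z /\ forall i, 0 <= x l i + (c %/ s i)%N%:Z.
  by move=> l; apply/in_coneP/xin.
have sumk : k = (\sum_l kk l)%N.
  apply/eqP; rewrite -eqz_nat -Ek /level; apply/eqP.
  rewrite Posz_sum; under [RHS]eq_bigr => l _ do rewrite -(kkP l).1.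
  rewrite /level sumrB sumr_const card_ord -natz exchange_big /=.
  by congr (_ - _); apply: eq_bigr => i _; rewrite zE.
have k_gt0 : (0 < k)%N.
  rewrite lt0n; apply/eqP => k0; move: hk.
  by rewrite k0 /floor_height big1 // => i _; rewrite div0n.
(* The levels of the summands add up to [k > 0], so they are not all zero. *)
have [l0 l0P] : exists l0, (0 < kk l0)%N.
  apply/existsP; apply: contraLR k_gt0; rewrite negb_exists => /forallP H.
  by rewrite sumk big1 // => l _; have := H l; rewrite lt0n negbK => /eqP.
have restE : (k - kk l0 = \sum_(l | l != l0) kk l)%N.
  by rewrite sumk (bigD1 l0) //= addKn.
have c_le : (kk l0 <= k)%N by rewrite sumk (bigD1 l0) //= leq_addr.
(* floor is superadditive, while the x l sum up to the minimal point over k, so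
   every inequality below is an equality *)
have supadd i : (\sum_(l | l != l0) kk l %/ s i <= (k - kk l0) %/ s i)%N.
  rewrite restE; elim/big_rec2: _ => // l a b _ le_ab.
  by rewrite divnD //; apply: leq_trans (leq_addr _ _); rewrite leq_add2l.
have supadd2 i : (kk l0 %/ s i + (k - kk l0) %/ s i <= k %/ s i)%N.
  by rewrite -{2}(subnKC c_le) divnD // leq_addr.
have zle i : (k %/ s i)%N%:Z <= - x l0 i + (\sum_(l | l != l0) kk l %/ s i)%N%:Z.
  have -> : (k %/ s i)%N%:Z = - z i by rewrite /z opprK.
  rewrite zE (bigD1 l0) //= opprD lerD2l Posz_sum -sumrN.
  by apply: ler_sum => l _; have := (kkP l).2 i; lia.
have xE i : x l0 i = - (kk l0 %/ s i)%N%:Z.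
  by have := (kkP l0).2 i; have := zle i; have := supadd i; have := supadd2 i; lia.
have h1 : floor_height (kk l0) = 1.
  rewrite /floor_height -(kkP l0).1 /level (eq_bigr _ (fun i _ => xE i)).
  by rewrite sumrN opprK addrK.
exists (kk l0); split=> //.
  rewrite ltn_neqAle c_le andbT; apply/eqP => E.
  by move: hk; rewrite -E h1.
by move=> i; have := zle i; have := supadd i; have := supadd2 i; rewrite xE; lia.
Qed.

(** By induction on the height, it is enough to remove one point of height 1 and stay in the
    cone. *)
Lemma floor_decomposable_cone : floor_decomposable -> cone_decomposable.
Proof.
move=> dec; elim=> [//|m IHm] z _ zin.
case: m IHm zin => [_ zin|m IHm zin].
  exists (fun=> z); split=> [l|i]; last by rewrite big_ord1.
  by case: l.
suff [y [yin zyin]] : exists y, in_cone y 1 /\ in_cone (fun i => z i - y i) m.+1.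
  have [//|x [xin zE]] := IHm _ _ zyin.
  exists (fun l => if (l == m.+1)%N then y else x l); split.
    by move=> l; rewrite ltnS leq_eqVlt; case: eqP => //= _ /xin.
  move=> i; rewrite big_ord_recr /= eqxx; apply/eqP; rewrite -subr_eq zE; apply/eqP.
  by apply: eq_bigr => l _; rewrite ltn_eqF.
have [k [Ek zk]] := (in_coneP _ _).1 zin.
(* If a coordinate exceeds its minimum, the vertex [e_i0] is removed. It has level 0, so [k] and all
   lower bounds are unchanged. Otherwise [z] is the minimal point over [k]. *)
case: (pickP (fun i0 => 0 < z i0 + (k %/ s i0)%N%:Z)) => [i0 gt0|le0].
  have sum1 : \sum_i (i == i0)%:Z = 1.
    by rewrite (bigD1 i0) //= eqxx big1 ?addr0 // => i /negPf ->.
  have level_e : level (fun i => (i == i0)%:Z) 1 = 0 by rewrite /level sum1.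
  exists (fun i => (i == i0)%:Z); split; apply/in_coneP.
    by exists 0%N; split=> // i; rewrite div0n addr0.
  exists k; split=> [|i]; first by rewrite levelB level_e subr0.
  by have := zk i; case: eqP => [->|_] /=; lia.
have zE i : z i = - (k %/ s i)%N%:Z.
  by have := zk i; have /negbT := le0 i; lia.
have hk : floor_height k = m.+2%:Z.
  by rewrite /floor_height -Ek /level (eq_bigr _ (fun i _ => zE i)) sumrN opprK addrK.
have [|c [c0 ck cE hc]] := dec k; first by rewrite hk; lia.
have level_c : level (fun i => - (c %/ s i)%N%:Z) 1 = c%:Z.
  by rewrite /level sumrN opprK -[X in X + _]hc subrK.
exists (fun i => - (c %/ s i)%N%:Z); split; apply/in_coneP.
  by exists c; split=> // i; rewrite addNr.
exists (k - c)%N; split=> [|i]; last by rewrite zE cE; lia.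
by rewrite levelB Ek level_c; lia.
Qed.

End Slopes.

(** * The numerical condition on the weights as a statement about floors *)

Section WeightedSimplex.

Variables (n : nat) (q : 'I_n -> nat).
Hypothesis q_gt0 : forall j, (0 < q j)%N.
Hypothesis q_div : forall j, (q j %| 1 + \sum_(i < n | i != j) q i)%N.

Definition total_weight : nat := (1 + \sum_i q i)%N.

Definition slope (i : 'I_n) : nat := (total_weight %/ q i)%N.

Lemma slopeE j : slope j = ((1 + \sum_(i < n | i != j) q i) %/ q j).+1.
Proof.
by rewrite /slope /total_weight (bigD1 j) //= addnCA divnDl ?dvdnn // divnn q_gt0.
Qed.

Lemma slopeM i : (slope i * q i = total_weight)%N.
Proof.
by rewrite slopeE mulSn divnK // /total_weight [in RHS](bigD1 i) //= addnCA.
Qed.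

Lemma slope_gt1 i : (1 < slope i)%N.
Proof. by rewrite slopeE ltnS divn_gt0 // dvdn_leq. Qed.

Lemma slope_gt0 i : (0 < slope i)%N.
Proof. exact: ltnW (slope_gt1 i). Qed.

(** Both [slope i * q i] and [slope j * q j] equal [total_weight], so
    [q i / q j = slope j / slope i]. *)
Lemma divn_weight i j b : ((b * q i) %/ q j = (slope j * b) %/ slope i)%N.
Proof.
rewrite -(divnMr (slope_gt0 j)) [(q j * _)%N]mulnC slopeM -(slopeM i).
by rewrite -mulnA [(q i * _)%N]mulnC mulnA divnMr // mulnC.
Qed.

(** The term [i = j] of [floor_height] is exactly [b], which cancels the extra 1 that [slope j] has
    over the quotient in [height]. *)
Lemma height_slope j b : height q j b = floor_height slope (slope j * b).
Proof.
rewrite /height /floor_height [in RHS](bigD1 j) //= mulKn ?slope_gt0 //.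
rewrite (eq_bigr _ (fun i _ => divn_weight i j b)) Posz_sum.
rewrite opprD addrA; congr (_ - _).
by rewrite slopeE mulSn PoszD [b%:Z + _]addrC addrK mulnC.
Qed.

Lemma floor_height_total : floor_height slope total_weight = 1.
Proof.
rewrite /floor_height (eq_bigr (fun i => (q i)%:Z)) => [|i _]; last first.
  by rewrite -(slopeM i) mulKn ?slope_gt0.
by rewrite -Posz_sum /total_weight; lia.
Qed.

Lemma floor_height1 : floor_height slope 1 = 1.
Proof.
by rewrite /floor_height big1 ?subr0 // => i _; rewrite divn_small ?slope_gt1.
Qed.

Definition weight_condition : Prop :=
  forall (j : 'I_n) (b : nat), (1 <= b <= q j - 1)%N ->
     2 <= height q j b ->
     exists c : nat,
       [/\ (0 < c)%N, (c < b)%N,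
           (forall i : 'I_n, i != j ->
              ((b * q i) %/ q j)%N%:Z - ((c * q i) %/ q j)%N%:Z
              = (((b - c) * q i) %/ q j)%N%:Z)
         & height q j c = 1].

Lemma weight_condition_floor : weight_condition -> floor_decomposable slope.
Proof.
move=> cond k hk.
have k_gt1 : (1 < k)%N.
  case: k hk => [|[|//]]; last by rewrite floor_height1.
  by rewrite /floor_height big1 // => i _; rewrite div0n.
have [ltQk|ltkQ|EkQ] := ltngtP total_weight k; last first.
- by move: hk; rewrite -EkQ floor_height_total.
- case: (pickP (fun j => slope j %| k)%N) => [j /dvdnP [b Eb]|ndvd].
    have [||c [c0 cb cE hc]] := cond j b.
    (* Here [k = slope j * b] is less than [total_weight = slope j * q j], whence [b < q j]. *)
    + have := ltkQ; rewrite -(slopeM j) Eb mulnC ltn_pmul2l ?slope_gt0 //.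
      by move: k_gt1; rewrite Eb; case: b {Eb} => // b _; lia.
    + by rewrite height_slope mulnC -Eb.
    exists (slope j * c)%N; split; rewrite -?height_slope //.
    + by rewrite muln_gt0 slope_gt0.
    + by rewrite Eb mulnC ltn_pmul2r ?slope_gt0.
    move=> i; rewrite Eb [(b * _)%N]mulnC -mulnBr.
    have [->|nij] := eqVneq i j; first by rewrite !mulKn ?slope_gt0 // subnKC // ltnW.
    by have := cE i nij; rewrite !divn_weight; lia.
  (* No slope divides [k], so passing from [k - 1] to [k] changes no quotient. *)
  exists 1%N; split; rewrite ?floor_height1 // => i.
  rewrite [(1 %/ _)%N]divn_small ?slope_gt1 // add0n subn1.
  have := ndvd i; case: (k) => // k' /= ndvdi.
  by rewrite divnS ?slope_gt0 // ndvdi.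
- exists total_weight; split; rewrite ?floor_height_total // => i.
  by rewrite -divnDl ?subnKC 1?ltnW // -(slopeM i) dvdn_mulr.
Qed.

Lemma floor_weight_condition : floor_decomposable slope -> weight_condition.
Proof.
move=> dec j b; rewrite height_slope => _ /dec [k [k0 kb kE hk]].
(* At index [j] the floor identity splits an exact multiple of [slope j], so the remainders of both
   parts must vanish. *)
have /dvdnP [c Ec] : (slope j %| k)%N.
  have := kE j; rewrite mulKn ?slope_gt0 // => Eb.
  have := divn_eq k (slope j); have := divn_eq (slope j * b - k) (slope j).
  have := slope_gt0 j; rewrite /dvdn; nia.
move: k0 kb kE hk; rewrite {}Ec [(c * _)%N]mulnC => k0 kb kE hk.
exists c; split; last by rewrite height_slope.
- by move: k0; rewrite muln_gt0 => /andP[].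
- by move: kb; rewrite ltn_pmul2l ?slope_gt0.
by move=> i _; have := kE i; rewrite -mulnBr !divn_weight; lia.
Qed.

(** * From the real simplex to integer points of the cone *)

Variable R : realType.

(** The inequalities are affine, so checking them at the vertices suffices in one direction. In the
    other, they make the barycentric coordinates nonnegative. *)
Lemma Delta1P (x : 'rV[R]_n) : Delta1 R q x <->
  0 <= 1 - \sum_i x 0 i /\
  forall i, 0 <= x 0 i * (slope i)%:R + (1 - \sum_i x 0 i).
Proof.
have slopeMR i : (slope i)%:R * (q i)%:R = total_weight%:R :> R.
  by rewrite -natrM slopeM.
have sumq : \sum_i (q i)%:R = total_weight%:R - 1 :> R.
  by rewrite /total_weight natrD natr_sum addrC addKr.
have apexE i : (- (\sum_i (q i)%:R *: delta_mx 0 i) : 'rV[R]_n) 0 i = - (q i)%:R.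
  rewrite mxE summxE (bigD1 i) //= big1 => [|l nli]; rewrite !mxE ?eqxx ?mulr1 ?addr0 //.
  by rewrite eq_sym (negPf nli) andbF mulr0.
split.
  case=> k [t [v [vA t0 t1 ->]]].
  have vP l : 0 <= 1 - \sum_i v l 0 i /\
      forall i, 0 <= v l 0 i * (slope i)%:R + (1 - \sum_i v l 0 i).
    case: (vA l) => [[j _ <-]|->].
      have -> : \sum_i (delta_mx 0 j : 'rV[R]_n) 0 i = 1.
        rewrite (bigD1 j) //= big1 => [|i nij]; rewrite !mxE ?eqxx ?addr0 //.
        by rewrite (negPf nij) andbF.
      rewrite subrr; split=> // i; rewrite addr0 mxE eqxx /=.
      by rewrite mulr_ge0 ?ler0n.
    rewrite (eq_bigr _ (fun i _ => apexE i)) sumrN sumq.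
    split=> [|i]; first by rewrite opprK addrC subrK ler0n.
    by rewrite apexE mulNr [_%:R * _]mulrC slopeMR; lra.
  have xE i : (\sum_l t l *: v l) 0 i = \sum_l t l * v l 0 i.
    by rewrite summxE; apply: eq_bigr => l _; rewrite mxE.
  have sumE : 1 - \sum_i (\sum_l t l *: v l) 0 i =
      \sum_l t l * (1 - \sum_i v l 0 i).
    under [RHS]eq_bigr => l _ do rewrite mulrBr mulr1 mulr_sumr.
    rewrite sumrB t1 exchange_big /=; congr (_ - _).
    by apply: eq_bigr => i _; rewrite xE.
  rewrite sumE; split=> [|i].
    by apply: sumr_ge0 => l _; rewrite mulr_ge0 // (vP l).1.
  rewrite xE mulr_suml -big_split /=; apply: sumr_ge0 => l _.
  by rewrite -mulrA -mulrDr mulr_ge0 // (vP l).2.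
move=> [x0 xi].
pose d : R := 1 - \sum_i x 0 i.
have Qgt0 : 0 < total_weight%:R :> R by rewrite ltr0n.
(* The barycentric coordinate of the apex: [1 - \sum_i x 0 i] vanishes at each [e_i] and equals
   [total_weight] at the apex. The coordinate at [e_i] is then [x 0 i + t0 * q i]. *)
pose t0 := d / total_weight%:R.
have lamE i : x 0 i + t0 * (q i)%:R = (x 0 i * (slope i)%:R + d) / (slope i)%:R.
  have s0 : (slope i)%:R != 0 :> R by rewrite pnatr_eq0 -lt0n slope_gt0.
  have q0 : (q i)%:R != 0 :> R by rewrite pnatr_eq0 -lt0n.
  by rewrite /t0 -(slopeMR i); field; rewrite s0 q0.
exists n.+1.
exists (fun l => if unlift ord0 l is Some i then x 0 i + t0 * (q i)%:R else t0).
exists (fun l => if unlift ord0 l is Some i then delta_mx 0 i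
                 else - (\sum_i (q i)%:R *: delta_mx 0 i)).
split.
- by move=> l; case: unliftP => [i|] _; [left; exists i|right].
- move=> l; case: unliftP => [i|] _; last by rewrite divr_ge0 // ltW.
  by rewrite lamE divr_ge0 ?ler0n.
- rewrite big_ord_recl unlift_none.
  under eq_bigr => i _ do rewrite liftK.
  rewrite big_split /= -mulr_sumr sumq /t0 /d.
  by field; rewrite gt_eqF.
- rewrite big_ord_recl unlift_none.
  under [X in _ + X]eq_bigr => i _ do rewrite liftK.
  apply/rowP => j; rewrite [RHS]mxE [X in _ = X + _]mxE apexE summxE.
  rewrite (bigD1 j) //= big1 => [|i nij]; rewrite !mxE ?eqxx /=; first by ring.
  by rewrite eq_sym (negPf nij) mulr0.
Qed.

Definition introw (z : 'I_n -> int) : 'rV[R]_n := \row_i (z i)%:~R.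

Lemma lattice_introw z : lattice_point (introw z).
Proof. by move=> i; rewrite mxE intr_int. Qed.

Lemma lattice_pointP (w : 'rV[R]_n) : lattice_point w -> exists z, w = introw z.
Proof.
move=> wint; exists (fun i => Num.floor (w 0 i)).
by apply/rowP => i; rewrite mxE floorK.
Qed.

Lemma introw_inj z z' : introw z = introw z' -> z =1 z'.
Proof. by move=> /rowP E i; have := E i; rewrite !mxE => /intr_inj. Qed.

Lemma introw_sum m (x : 'I_m -> 'I_n -> int) :
  \sum_l introw (x l) = introw (fun i => \sum_l x l i).
Proof.
apply/rowP => i; rewrite summxE mxE rmorph_sum /=.
by apply: eq_bigr => l _; rewrite mxE.
Qed.

(** Dividing by [m > 0] scales each facet inequality by a positive factor and keeps its sign. *)
Lemma dilate_Delta1P m z : (0 < m)%N ->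
  dilate m (Delta1 R q) (introw z) <-> in_cone slope z m.
Proof.
move=> m0; have mR : 0 < m%:R :> R by rewrite ltr0n.
have mN0 : m%:R != 0 :> R by rewrite gt_eqF.
have -> : dilate m (Delta1 R q) (introw z) <-> Delta1 R q (m%:R^-1 *: introw z).
  split=> [[x xD <-]|D]; first by rewrite scalerA mulVf // scale1r.
  by exists (m%:R^-1 *: introw z) => //; rewrite scalerA divff // scale1r.
have coordE i : (m%:R^-1 *: introw z) 0 i = m%:R^-1 * (z i)%:~R by rewrite !mxE.
have levelE : 1 - \sum_i (m%:R^-1 *: introw z) 0 i = m%:R^-1 * (level z m)%:~R.
  rewrite (eq_bigr _ (fun i _ => coordE i)) -mulr_sumr /level.
  by rewrite rmorphB rmorph_sum /= mulrBr mulVf.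
have scaleE (u : int) : (0 <= m%:R^-1 * u%:~R :> R) = (0 <= u).
  by rewrite pmulr_rge0 ?invr_gt0 // ler0z.
have ineqE i : (0 <= (m%:R^-1 *: introw z) 0 i * (slope i)%:R +
      (1 - \sum_i (m%:R^-1 *: introw z) 0 i)) = (0 <= z i * (slope i)%:Z + level z m).
  by rewrite levelE coordE -mulrA -mulrDr -[RHS]scaleE [in RHS]intrD intrM.
rewrite Delta1P levelE scaleE; split=> -[H0 H]; split=> // i.
  by rewrite -ineqE levelE.
by rewrite -levelE ineqE.
Qed.

Lemma Delta1_introw z : Delta1 R q (introw z) <-> in_cone slope z 1.
Proof.
rewrite -dilate_Delta1P //; split=> [D|[x D <-]]; last by rewrite scale1r.
by exists (introw z); rewrite ?scale1r.
Qed.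

Lemma IDP_Delta1P : IDP (Delta1 R q) <-> cone_decomposable slope.
Proof.
split=> dec m => [z m0 /(dilate_Delta1P _ m0) zin|m0 w win /lattice_pointP [z Ez]].
  have [x [xP zE]] := dec m m0 _ zin (lattice_introw z).
  have /fin_all_exists [y yE] l := lattice_pointP (xP l).2.
  have yin l : in_cone slope (y l) 1 by apply/Delta1_introw; rewrite -yE; exact: (xP l).1.
  (* The value 0 for indices from [m] on is a mere filler, as only [l < m] enters the sum. *)
  exists (fun l => if insub l is Some l' then y l' else fun=> 0); split.
    by move=> l lm; rewrite insubT; apply: yin.
  apply: introw_inj; rewrite zE (eq_bigr _ (fun l _ => yE l)) introw_sum.
  apply/rowP => i; rewrite !mxE; congr _%:~R.
  by apply: eq_bigr => l _; rewrite valK.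
move: win; rewrite Ez => /(dilate_Delta1P _ m0) /(dec m z m0) [x [xin zE]].
exists (fun l : 'I_m => introw (x l)); split.
  by move=> l; split; [apply/Delta1_introw/xin|apply: lattice_introw].
by rewrite introw_sum; apply/rowP => i; rewrite !mxE zE.
Qed.

End WeightedSimplex.

Theorem theorem2p3 (R : realType) (n : nat) (q : 'I_n -> nat)
    (q_incr : forall i j : 'I_n, (i <= j)%N -> (q i <= q j)%N)
    (q_pos : forall j : 'I_n, (0 < q j)%N)
    (q_div : forall j : 'I_n, (q j %| 1 + \sum_(i < n | i != j) q i)%N) :
  IDP (Delta1 R q) <->
  (forall (j : 'I_n) (b : nat), (1 <= b <= q j - 1)%N ->
     2 <= height q j b ->
     exists c : nat,
       [/\ (0 < c)%N, (c < b)%N,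
           (forall i : 'I_n, i != j ->
              ((b * q i) %/ q j)%N%:Z - ((c * q i) %/ q j)%N%:Z
              = (((b - c) * q i) %/ q j)%N%:Z)
         & height q j c = 1]).
Proof.
have s_gt0 := slope_gt0 q_pos q_div.
rewrite IDP_Delta1P //; split=> [dec|cond].
  exact: (floor_weight_condition q_pos q_div (cone_decomposable_floor s_gt0 dec)).
exact: (floor_decomposable_cone s_gt0 (weight_condition_floor q_pos q_div cond)).
Qed.
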